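(* Let $q\in(0,1)$, let $\gamma>0$ be real, let $0<p<\infty$, let $\mathfrak X\in\{\ell_p,\ell_\infty\}$, and let $\mathfrak Y\subset\omega$ be an arbitrary sequence space. Put $b_n=\frac{1}{[n]_q!}\prod_{i=0}^{n-1}[\gamma+i]_q$ for integers $n\ge0$. Let $\Phi=(\phi_{jk})_{j,k\in\mathbb{Z}^+_0}$ be an infinite matrix of complex numbers and for $j,k,m\in\mathbb{Z}^+_0$ put $$\psi^{(j)}_{mk}=\begin{cases}\sum_{v=k}^{m}b_{v-k}\,\phi_{jv},&0\le k\le m,\\0,&k>m,\end{cases}\qquad \psi_{jk}=\sum_{v=k}^{\infty}b_{v-k}\,\phi_{jv}.$$ Then $\Phi\in(\mathfrak X(\nabla^{(\gamma)}_q),\mathfrak Y)$ if and only if both of the following hold: $$\Psi^{(j)}=(\psi^{(j)}_{mk})_{m,k}\in(\mathfrak X,c)\quad\text{for every }j\in\mathbb{Z}^+_0,$$ $$\Psi=(\psi_{jk})_{j,k}\in(\mathfrak X,\mathfrak Y).$$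
   Context: $\mathbb{Z}^+_0=\{0,1,2,\dots\}$; $\omega$ is the space of all complex sequences $(g_j)_{j\in\mathbb{Z}^+_0}$; a sequence space is a linear subspace of $\omega$; $c$ is the space of convergent sequences. For real $x$, $[x]_q=\frac{1-q^x}{1-q}$; $[0]_q!=1$ and $[k]_q!=\prod_{i=1}^k[i]_q$. Empty products equal $1$. The $q$-difference operator $\nabla^{(\gamma)}_q:\omega\to\omega$ is $$(\nabla^{(\gamma)}_q g)_j=\sum_{k=0}^{j}(-1)^{j-k}q^{\binom{j-k}{2}}\frac{\prod_{i=0}^{j-k-1}[\gamma-i]_q}{[j-k]_q!}\,g_k,$$ and $\mathfrak X(\nabla^{(\gamma)}_q)=\{g\in\omega:\nabla^{(\gamma)}_q g\in\mathfrak X\}$. For sequence spaces $\mathfrak A,\mathfrak B$, $(\mathfrak A,\mathfrak B)$ is the set of infinite complex matrices $\Phi=(\phi_{jk})$ such that for every $g\in\mathfrak A$ the series $(\Phi g)_j=\sum_{k=0}^\infty\phi_{jk}g_k$ converges for every $j$ and $\Phi g=((\Phi g)_j)_j\in\mathfrak B$. The second condition includes convergence of the series defining $\psi_{jk}$, which is guaranteed by the first condition (these series are the limits of $\psi^{(j)}_{mk}$ as $m\to\infty$). *)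

(* Defs.v *)
From HB Require Import structures.
From mathcomp Require Import all_boot all_order all_algebra.
From mathcomp Require Import all_classical all_reals all_analysis.
From mathcomp Require Import complex.
Set Implicit Arguments.
Unset Strict Implicit.
Unset Printing Implicit Defensive.
Import Order.TTheory GRing.Theory Num.Theory.
Import numFieldNormedType.Exports.
Local Open Scope classical_set_scope.
Local Open Scope ring_scope.
Local Open Scope complex_scope.

(* The norm topology is found by unification on the regular algebra
   [R[i]^o], not on [R[i]] itself; the two types are convertible. *)
Notation Cplx R := (R[i]^o) (only parsing).

Notation omega R := (nat -> Cplx R) (only parsing).

Definition sequence_space (R : realType) (X : set (omega R)) : Prop :=
  submod_closed (mem X).

(* For 0 < p < oo; for such p, [0 `^ p = 0]. *)
Definition ell (R : realType) (p : R) : set (omega R) :=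
  [set g | cvgn (series (fun k => Normc.normc (g k) `^ p))].

Definition ell_infty (R : realType) : set (omega R) := [set g | bounded_fun g].

Definition cseq (R : realType) : set (omega R) := [set g | cvgn g].

Definition matrix_class (R : realType) (A B : set (omega R)) :
    set (nat -> nat -> Cplx R) :=
  [set Phi | forall g : omega R, A g ->
     (forall j, cvgn (series (fun k => Phi j k * g k))) /\
     B (fun j => limn (series (fun k => Phi j k * g k)))].

Definition qnum (R : realType) (q x : R) : R := (1 - q `^ x) / (1 - q).

Definition qfact (R : realType) (q : R) (n : nat) : R :=
  \prod_(1 <= i < n.+1) qnum q i%:R.

Definition nabla (R : realType) (q gamma : R) (g : omega R) : omega R :=
  fun j => \sum_(0 <= k < j.+1)
    ((-1) ^+ (j - k) * q ^+ 'C(j - k, 2) *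
      ((\prod_(0 <= i < j - k) qnum q (gamma - i%:R)) / qfact q (j - k)))%:C *
    g k.

Definition nabla_domain (R : realType) (q gamma : R) (X : set (omega R)) :
    set (omega R) :=
  nabla q gamma @^-1` X.

Definition bcoef (R : realType) (q gamma : R) (n : nat) : R :=
  (qfact q n)^-1 * \prod_(0 <= i < n) qnum q (gamma + i%:R).

Definition psi_section (R : realType) (q gamma : R) (Phi : nat -> nat -> Cplx R)
    (j : nat) : nat -> nat -> Cplx R :=
  fun m k => if (k <= m)%N
    then \sum_(k <= v < m.+1) (bcoef q gamma (v - k))%:C * Phi j v else 0.

Definition psi_partial (R : realType) (q gamma : R) (Phi : nat -> nat -> Cplx R)
    (j k : nat) : omega R :=
  fun n => \sum_(k <= v < n) (bcoef q gamma (v - k))%:C * Phi j v.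

(* [limn] is total, so these entries are meaningful only when the sequences
   [psi_partial q gamma Phi j k] converge. *)
Definition psi_matrix (R : realType) (q gamma : R) (Phi : nat -> nat -> Cplx R) :
    nat -> nat -> Cplx R :=
  fun j k => limn (psi_partial q gamma Phi j k).

(* Main.v *)
Require Import Defs.
From HB Require Import structures.
From mathcomp Require Import all_boot all_order all_algebra.
From mathcomp Require Import all_classical all_reals all_analysis.
From mathcomp Require Import complex.
From mathcomp Require Import ring.
Set Implicit Arguments.
Unset Strict Implicit.
Unset Printing Implicit Defensive.
Import Order.TTheory GRing.Theory Num.Theory.
Import numFieldNormedType.Exports.
Local Open Scope classical_set_scope.
Local Open Scope ring_scope.
Local Open Scope complex_scope.

(** The operator [nabla q gamma] is convolution with the coefficients of
    (z; q)_gamma, and [bcoef] lists the coefficients of the reciprocal power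
    series. Both coefficient sequences satisfy a two-term recurrence, which
    forces their convolution to be the unit ([qbinomial_inverse]). Hence
    f |-> b * f is a bijection from X onto [nabla_domain q gamma X], with
    inverse [nabla] ([nablaK], [nabla_conv]).

    For g = b * f, exchanging the two finite summations shows that the m-th
    partial sum of the j-th series of Phi g is the m-th entry of Psi^(j) f
    ([sum_mul_conv]). So all these series converge if and only if every Psi^(j)
    maps X into c. It remains to identify their sums: if A is a row-triangular
    matrix mapping X into c, then for f in X
      lim_m sum_k A_mk f_k = sum_k (lim_m A_mk) f_k,
    where the series on the right converges ([triangular_limit_series]). With
    A = Psi^(j) this says that the j-th entries of Phi g and Psi f agree, so one
    sequence is in Y exactly when the other is.

    Both choices of X are closed under replacing entries by 0. Therefore the
    matrix B_mk = A_mk f_k has convergent masked row sums sum_k u_k B_mk for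
    every 0/1 sequence u, and the interchange of limits becomes a statement on
    such B alone, without any trace of X or p ([series_column_limits]). It is
    proved by a gliding hump: if the tails of the rows of B were not uniformly
    small, one could choose u so that its masked row sums oscillate
    ([tail_uniformly_small]); uniformly small tails allow the interchange. *)

(** * Interchange of limits for masked row sums *)

Lemma cvgn_cauchy (K : numFieldType) (V : normedModType K) (f : nat -> V)
    (e : K) :
  cvgn f -> 0 < e ->
  exists M, forall r r', (M <= r)%N -> (M <= r')%N -> `|f r - f r'| <= e.
Proof.
move=> fl e0.
have e20 : 0 < e / 2 by rewrite divr_gt0.
move/cvgrPdist_le : fl => /(_ _ e20) [M _ hM].
exists M => r r' Mr Mr'; rewrite -(subrKA (limn f)) [e]splitr.
apply: le_trans (ler_normD _ _) _; apply: lerD; last exact: hM.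
by rewrite distrC; exact: hM.
Qed.

(** Cutting the sum at m makes B row-triangular, whatever its entries above the
    diagonal. *)
Definition masked_row_sum (V : zmodType) (B : nat -> nat -> V) (u : pred nat)
    (m : nat) : V :=
  \sum_(0 <= k < m.+1 | u k) B m k.

Section GlidingHump.
Variables (K : numFieldType) (V : normedModType K) (B : nat -> nat -> V).
Hypothesis masked_cvg : forall u, cvgn (masked_row_sum B u).

Lemma column_cvg k : cvgn (B^~ k).
Proof.
apply: (cvgP (limn (masked_row_sum B (pred1 k)))).
apply: cvg_trans; last exact: masked_cvg.
apply: near_eq_cvg.
near=> m; have km : (k <= m)%N by near: m; exact: nbhs_infty_ge.
rewrite /masked_row_sum big_mkcond (bigD1_seq k) ?mem_index_iota ?iota_uniq//=.
by rewrite eqxx big1 ?addr0// => i /negPf ->.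
Unshelve. all: by end_near.
Qed.

(** The bound is uniform in the mask: this lets the gliding hump construction
    fix a row index before the mask is known. *)
Lemma head_cauchy N (e : K) : 0 < e ->
  exists M, forall r r' (u : pred nat), (M <= r)%N -> (M <= r')%N ->
    `|\sum_(0 <= k < N | u k) (B r k - B r' k)| <= e.
Proof.
elim: N e => [|N IH] e e0.
  by exists 0 => r r' u _ _; rewrite big_geq// normr0 ltW.
have e20 : 0 < e / 2 by rewrite divr_gt0.
have [M1 hM1] := IH _ e20.
have [M2 hM2] := cvgn_cauchy (@column_cvg N) e20.
exists (maxn M1 M2) => r r' u; rewrite !geq_max => /andP[r1 r2] /andP[r1' r2'].
rewrite big_mkcond big_nat_recr//= -big_mkcond/= [e]splitr.
apply: le_trans (ler_normD _ _) _; apply: lerD; first exact: hM1.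
by case: (u N); [exact: hM2 | rewrite normr0 ltW].
Qed.

(** Otherwise there are arbitrarily late blocks [n, r] with a large sum in
    row r. Blocks are selected one after another, each preceded by a gap that
    contains a row index r0. For the mask u of the union of the blocks, row r0
    only sees the columns before the gap, while row r sees these columns and its
    block; since the columns converge, the masked sums of rows r0 and r differ
    by about the sum of the block, which contradicts their convergence. *)
Lemma tail_uniformly_small (e : K) : 0 < e ->
  exists N, forall n m, (N <= n)%N -> `|\sum_(n <= k < m.+1) B m k| <= e.
Proof.
move=> e0; apply: contrapT => hno.
have e20 : 0 < e / 2 by rewrite divr_gt0.
(* The triple s is (r0, n, r); the columns below N are already decided. *)
have hump N : exists s : nat * nat * nat,
    [/\ (N <= s.1.1)%N, (s.1.1 < s.1.2)%N, (s.1.2 <= s.2)%N,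
     ~ `|\sum_(s.1.2 <= k < s.2.+1) B s.2 k| <= e &
     forall u : pred nat,
       `|\sum_(0 <= k < N | u k) (B s.2 k - B s.1.1 k)| <= e / 2].
  have [M hM] := head_cauchy N e20.
  apply: contrapT => hN; apply: hno; exists (maxn M N).+1 => n m nge.
  apply: contrapT => hbig.
  (* The tail of row m ends at column m, so a large tail forces m >= n. *)
  have nm : (n <= m)%N.
    rewrite leqNgt; apply/negP => mn; apply: hbig.
    by rewrite big_geq ?normr0 ?ltW.
  apply: hN; exists (maxn M N, n, m); split => //=; first exact: leq_maxr.
  move=> u; apply: hM; last exact: leq_maxl.
  by rewrite (leq_trans _ nm)// (leq_trans _ nge)// ltnW// ltnS leq_maxl.
have [s hs] := choice hump.
pose N i := iter i (fun n => (s n).2.+1) 0%N.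
have Nincr i : (N i < N i.+1)%N.
  have [h1 /ltnW h2 h3 _ _] := hs (N i).
  by rewrite [N i.+1]/= ltnS (leq_trans h1)// (leq_trans h2).
have Nle i j : (i <= j)%N -> (N i <= N j)%N.
  elim: j => [|j IH]; first by rewrite leqn0 => /eqP ->.
  by rewrite leq_eqVlt => /predU1P[->//|/IH h]; apply: leq_trans h (ltnW _).
have Nge i : (i <= N i)%N.
  by elim: i => // i IH; apply: leq_ltn_trans IH _.
pose u k := `[< exists i, ((s (N i)).1.2 <= k < N i.+1)%N >].
have uE i k : (N i <= k < N i.+1)%N -> u k = ((s (N i)).1.2 <= k)%N.
  move=> /andP[Nk kN]; apply/asboolP/idP => [[j /andP[jk kj]]|ik]; last first.
    by exists i; rewrite ik kN.
  case: (ltngtP i j) => [ij|ji|->//].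
  - have := Nle _ _ ij; have [h1 h2 _ _ _] := hs (N j).
    by move=> h; have := leq_trans (leq_ltn_trans h1 h2) jk;
      rewrite ltnNge => /negP[]; apply: leq_trans (ltnW kN) h.
  - by have := leq_trans kj (leq_trans (Nle _ _ ji) Nk); rewrite ltnn.
have [M hM] := cvgn_cauchy (@masked_cvg u) e20.
have [h1 h2 h3 hbig hhead] := hs (N M).
set r0 := (s (N M)).1.1 in h1 h2 hhead; set n := (s (N M)).1.2 in h2 h3 hbig.
set r := (s (N M)).2 in h3 hbig hhead.
have Mr0 : (M <= r0)%N by apply: leq_trans (Nge M) h1.
have Mr : (M <= r)%N by rewrite (leq_trans Mr0)// (leq_trans (ltnW h2)).
apply: hbig.
have row0 : masked_row_sum B u r0 = \sum_(0 <= k < N M | u k) B r0 k.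
  rewrite /masked_row_sum (@big_cat_nat _ _ _ (N M))//=; last exact: leqW.
  rewrite [X in _ + X]big_nat_cond [X in _ + X]big_pred0 ?addr0// => k.
  apply/negP => /andP[/andP[Nk kr]]; rewrite (uE M).
    by rewrite -/n leqNgt (leq_ltn_trans _ h2).
  by rewrite Nk /= ltnS; rewrite ltnS in kr;
    rewrite (leq_trans kr)// (leq_trans (ltnW h2)).
have row1 : masked_row_sum B u r =
    \sum_(0 <= k < N M | u k) B r k + \sum_(n <= k < r.+1) B r k.
  rewrite /masked_row_sum (@big_cat_nat _ _ _ (N M))//=; last first.
    exact: ltnW (Nincr M).
  congr (_ + _).
  rewrite (@big_cat_nat _ _ _ n)//=;
    [|by rewrite (leq_trans h1)// ltnW|exact: leqW].
  rewrite big_nat_cond big_pred0 ?add0r; last first.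
    move=> k; apply/negP => /andP[/andP[Nk kn]]; rewrite (uE M).
      by rewrite -/n leqNgt kn.
    by rewrite Nk /= ltnS (leq_trans (ltnW kn)).
  rewrite big_nat_cond [RHS]big_nat_cond; apply: eq_bigl => k.
  case: (boolP (n <= k < r.+1)%N) => //= /andP[nk kr].
  by rewrite (uE M) ?nk// (leq_trans h1) ?(leq_trans (ltnW h2)).
have -> : \sum_(n <= k < r.+1) B r k =
  (masked_row_sum B u r - masked_row_sum B u r0) -
  \sum_(0 <= k < N M | u k) (B r k - B r0 k).
  by rewrite row0 row1 sumrB opprB subrKA addrAC subrr add0r.
rewrite [e]splitr; apply: le_trans (ler_normB _ _) _.
by apply: lerD; [exact: hM | exact: hhead].
Qed.

(** The tails being uniformly small, the n-th partial sum of the column limits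
    is compared with the limit of the row sums through one late row m. *)
Lemma series_column_limits :
  series (fun k => limn (B^~ k)) @ \oo --> limn (masked_row_sum B xpredT).
Proof.
apply/cvgrPdist_le => e e0.
have e20 : 0 < e / 2 by rewrite divr_gt0.
have e40 : 0 < e / 2 / 2 by rewrite divr_gt0.
have [N hN] := tail_uniformly_small e20.
near=> n.
have nN : (N <= n)%N by near: n; exact: nbhs_infty_ge.
have headl : (fun m => \sum_(0 <= k < n) B m k) @ \oo -->
    \sum_(0 <= k < n) limn (B^~ k).
  by apply: (cvg_big add_continuous) => k _; exact: column_cvg.
have /cvgrPdist_le/(_ _ e40) [M1 _ hM1] := headl.
have /cvgrPdist_le/(_ _ e40) [M2 _ hM2] := @masked_cvg xpredT.
pose m := maxn n (maxn M1 M2).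
have h1 : (M1 <= m)%N by rewrite /m !leq_max leqnn orbT.
have h2 : (M2 <= m)%N by rewrite /m !leq_max leqnn !orbT.
have nm : (n <= m.+1)%N by rewrite leqW// leq_maxl.
have {h1}/= := hM1 _ h1; have {h2}/= := hM2 _ h2; have := hN n m nN.
have -> : masked_row_sum B xpredT m =
    \sum_(0 <= k < n) B m k + \sum_(n <= k < m.+1) B m k.
  by rewrite /masked_row_sum (@big_cat_nat _ _ _ n).
rewrite /series/=; set l := limn _; set t := \sum_(n <= k < _) _.
set a := \sum_(0 <= k < n) B m k; set b := \sum_(0 <= k < n) limn _.
move=> ht hl; rewrite distrC => hab.
have -> : l - b = t + ((l - (a + t)) + (a - b)).
  by rewrite [a + t]addrC opprD [l + (- t - a)]addrA subrKA addrA subrKC.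
rewrite [e]splitr [X in _ <= _ + X]splitr.
apply: le_trans (ler_normD _ _) _; apply: lerD => //.
by apply: le_trans (ler_normD _ _) _; apply: lerD.
Unshelve. all: by end_near.
Qed.

End GlidingHump.

(** * Convolution and the inverse of the q-difference operator *)

Definition conv (K : comNzRingType) (a g : nat -> K) (n : nat) : K :=
  \sum_(0 <= k < n.+1) a (n - k)%N * g k.

(** Truncated polynomials turn convolution into a ring product, whose
    associativity and commutativity then carry over. *)
Lemma coef_conv (K : comNzRingType) (a g : nat -> K) (N n : nat) : (n < N)%N ->
  conv a g n = (\poly_(i < N) a i * \poly_(i < N) g i)`_n.
Proof.
move=> nN; rewrite coefMr /conv big_mkord; apply: eq_bigr => k _.
by rewrite !coef_poly (leq_ltn_trans (leq_subr _ _) nN) (leq_trans (ltn_ord k)).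
Qed.

Lemma conv_assoc (K : comNzRingType) (a b g : nat -> K) :
  conv a (conv b g) = conv (conv a b) g.
Proof.
apply/funext => n.
transitivity ((\poly_(i < n.+1) a i * \poly_(i < n.+1) b i *
  \poly_(i < n.+1) g i)`_n).
  rewrite -mulrA coefMr /conv big_mkord; apply: eq_bigr => k _.
  by rewrite coef_poly ltnS leq_subr -coef_conv.
rewrite coefMr /conv big_mkord; apply: eq_bigr => k _.
by rewrite coef_poly ltn_ord -coef_conv// ltnS leq_subr.
Qed.

Lemma convC (K : comNzRingType) (a b : nat -> K) : conv a b = conv b a.
Proof. by apply/funext => n; rewrite !(@coef_conv _ _ _ n.+1)// mulrC. Qed.

Lemma conv_unit (K : comNzRingType) (g : nat -> K) :
  conv (fun n => (n == 0)%:R) g = g.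
Proof.
apply/funext => n; rewrite /conv big_nat_recr//= subnn mul1r big_nat_cond.
rewrite big1 ?add0r// => k /andP[/andP[_ kn] _].
by rewrite subn_eq0 leqNgt kn mul0r.
Qed.

(** With b the sequence [bcoef] and phi the j-th row of Phi, the right-hand side
    is an entry of Psi^(j) f. *)
Lemma sum_mul_conv (K : comNzRingType) (phi b f : nat -> K) (m : nat) :
  \sum_(0 <= k < m) phi k * conv b f k =
  \sum_(0 <= k < m) (\sum_(k <= v < m) b (v - k)%N * phi v) * f k.
Proof.
under eq_big_nat => k /andP[_ km].
  rewrite /conv (@big_nat_widen _ _ _ 0 k.+1 m)//= mulr_sumr; over.
rewrite (exchange_big_dep_nat xpredT)//=; apply: eq_bigr => k _.
rewrite mulr_suml [RHS](@big_nat_widenl _ _ _ _ 0)//=.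
by apply: eq_bigr => v _; rewrite mulrCA mulrA.
Qed.

(** With A and B the generating series, the recurrences read
    (1 - x z) A(z) = (1 - z) A(q z) and (1 - z) B(z) = (1 - x z) B(q z).
    So C = A B satisfies C(z) = C(q z), and each coefficient of C of positive
    degree is zero. On coefficients, the proof shows that (1 - q^n) c_n does not
    depend on n. *)
Lemma qbinomial_inverse (K : idomainType) (q x : K) (a b : nat -> K) :
  (forall n, 1 - q ^+ n.+1 != 0) -> a 0%N = 1 -> b 0%N = 1 ->
  (forall n, (1 - q ^+ n.+1) * a n.+1 = (x - q ^+ n) * a n) ->
  (forall n, (1 - q ^+ n.+1) * b n.+1 = (1 - x * q ^+ n) * b n) ->
  conv a b = (fun n => (n == 0)%:R).
Proof.
move=> q0 a0 b0 arec brec.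
have crec n : (1 - q ^+ n.+1) * conv a b n.+1 = (1 - q ^+ n) * conv a b n.
  (* 1 - q^(n+1) = q^k (1 - q^(n+1-k)) + (1 - q^k) *)
  have -> : (1 - q ^+ n.+1) * conv a b n.+1 =
      \sum_(0 <= k < n.+2)
        q ^+ k * ((1 - q ^+ (n.+1 - k)) * a (n.+1 - k)%N) * b k +
      \sum_(0 <= k < n.+2) a (n.+1 - k)%N * ((1 - q ^+ k) * b k).
    rewrite /conv mulr_sumr -big_split/=; apply: eq_big_nat => k /andP[_ kn].
    have -> : q ^+ n.+1 = q ^+ k * q ^+ (n.+1 - k) by rewrite -exprD subnKC.
    by ring.
  rewrite big_nat_recr//= subnn expr0 subrr mul0r mulr0 mul0r addr0.
  rewrite [X in _ + X]big_nat_recl//= expr0 subrr mul0r mulr0 add0r.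
  rewrite -big_split/= /conv mulr_sumr; apply: eq_big_nat => k /andP[_ kn].
  rewrite subSS subSn// arec brec.
  have -> : q ^+ n = q ^+ k * q ^+ (n - k) by rewrite -exprD subnKC.
  by ring.
have c0 n : (1 - q ^+ n) * conv a b n = 0.
  by elim: n => [|n IH]; [rewrite expr0 subrr mul0r | rewrite crec].
apply/funext => -[|n]; first by rewrite /conv big_nat1 a0 b0 mulr1.
by have /eqP := c0 n.+1; rewrite mulf_eq0 (negPf (q0 n)) => /eqP.
Qed.

Definition nabla_coef (R : realType) (q gamma : R) (n : nat) : R :=
  (-1) ^+ n * q ^+ 'C(n, 2) *
    ((\prod_(0 <= i < n) qnum q (gamma - i%:R)) / qfact q n).

Section QCoefficients.
Variables (R : realType) (q gamma : R).
Hypotheses (hq0 : 0 < q) (hq1 : q < 1).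

Let subr_exp_neq0 n : 1 - q ^+ n.+1 != 0.
Proof. by rewrite subr_eq0 eq_sym lt_eqF// exprn_ilt1// ltW. Qed.

Let subr_q_neq0 : 1 - q != 0.
Proof. by rewrite subr_eq0 gt_eqF. Qed.

Lemma qnum_nat n : qnum q n%:R = (1 - q ^+ n) / (1 - q).
Proof. by rewrite /qnum powR_mulrn// ltW. Qed.

Lemma qfactS n : qfact q n.+1 = qfact q n * ((1 - q ^+ n.+1) / (1 - q)).
Proof. by rewrite /qfact big_nat_recr//= qnum_nat. Qed.

Lemma qfact_neq0 n : qfact q n != 0.
Proof.
elim: n => [|n IH]; first by rewrite /qfact big_geq// oner_eq0.
by rewrite qfactS !mulf_neq0// invr_eq0.
Qed.

(** The power of q in the definition clears the denominator of
    q^(gamma - n), so that only q^gamma and powers of q remain. *)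
Lemma nabla_coefS n :
  (1 - q ^+ n.+1) * nabla_coef q gamma n.+1 =
  (q `^ gamma - q ^+ n) * nabla_coef q gamma n.
Proof.
have qn0 : q ^+ n != 0 by rewrite expf_neq0// gt_eqF.
have -> : nabla_coef q gamma n.+1 = - (q ^+ n * nabla_coef q gamma n *
    (qnum q (gamma - n%:R) / ((1 - q ^+ n.+1) / (1 - q)))).
  rewrite /nabla_coef big_nat_recr//= qfactS binS bin1 exprD exprS.
  by field; rewrite ?qn0 ?subr_q_neq0 ?subr_exp_neq0 ?qfact_neq0.
have -> : qnum q (gamma - n%:R) = (1 - q `^ gamma / q ^+ n) / (1 - q).
  rewrite /qnum powRD ?powRN ?powR_mulrn ?(ltW hq0)//.
  by rewrite [q == 0]gt_eqF ?implybT.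
by field; rewrite ?qn0 ?subr_q_neq0 ?subr_exp_neq0 ?qfact_neq0.
Qed.

Lemma bcoefS n :
  (1 - q ^+ n.+1) * bcoef q gamma n.+1 =
  (1 - q `^ gamma * q ^+ n) * bcoef q gamma n.
Proof.
rewrite /bcoef big_nat_recr//= qfactS.
have -> : qnum q (gamma + n%:R) = (1 - q `^ gamma * q ^+ n) / (1 - q).
  rewrite /qnum powRD ?powR_mulrn ?(ltW hq0)//.
  by rewrite [q == 0]gt_eqF ?implybT.
by field; rewrite ?qn0 ?subr_q_neq0 ?subr_exp_neq0 ?qfact_neq0.
Qed.

Lemma conv_nabla_coef_bcoef :
  conv (nabla_coef q gamma) (bcoef q gamma) = (fun n => (n == 0)%:R).
Proof.
apply: (@qbinomial_inverse _ q (q `^ gamma)) => //.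
- by rewrite /nabla_coef /qfact !big_geq// bin0n !expr0 invr1 !mulr1.
- by rewrite /bcoef /qfact !big_geq// invr1 mulr1.
- exact: nabla_coefS.
- exact: bcoefS.
Qed.

Lemma nablaE (g : omega R) :
  nabla q gamma g = conv (fun n => (nabla_coef q gamma n)%:C : R[i]^o) g.
Proof. by []. Qed.

Let conv_complex :
  conv (fun n => (nabla_coef q gamma n)%:C : R[i]^o)
    (fun n => (bcoef q gamma n)%:C) =
  (fun n => (n == 0)%:R).
Proof.
apply/funext => n.
transitivity ((conv (nabla_coef q gamma) (bcoef q gamma) n)%:C).
  rewrite /conv rmorph_sum; apply: eq_bigr => k _; exact/esym/rmorphM.
by rewrite conv_nabla_coef_bcoef; case: (n == 0)%N.
Qed.

Lemma nablaK (g : omega R) :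
  conv (fun n => (bcoef q gamma n)%:C : R[i]^o) (nabla q gamma g) = g.
Proof.
by rewrite nablaE conv_assoc [conv (fun n => (bcoef _ _ _)%:C) _]convC
  conv_complex conv_unit.
Qed.

Lemma nabla_conv (f : omega R) :
  nabla q gamma (conv (fun n => (bcoef q gamma n)%:C : R[i]^o) f) = f.
Proof. by rewrite nablaE conv_assoc conv_complex conv_unit. Qed.

End QCoefficients.

(** * Row-triangular matrices from X to c *)

Definition mask (V : zmodType) (u : pred nat) (f : nat -> V) (k : nat) : V :=
  if u k then f k else 0.

Definition delta (K : nzRingType) (j k : nat) : K := (k == j)%:R.

Lemma cvgn_series_finite (K : numFieldType) (V : normedModType K) (f : nat -> V)
    (m : nat) :
  (forall k, (m <= k)%N -> f k = 0) ->
  series f @ \oo --> \sum_(0 <= k < m) f k.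
Proof.
move=> f0; apply: cvg_near_cst; near=> n.
have mn : (m <= n)%N by near: n; exact: nbhs_infty_ge.
rewrite /series/= (@big_cat_nat _ _ _ m)//= [X in _ + X]big_nat_cond.
by rewrite [X in _ + X]big1 ?addr0// => k /andP[/andP[/f0]].
Unshelve. all: by end_near.
Qed.

Lemma ell_mask (R : realType) (p : R) (u : pred nat) (f : omega R) :
  0 < p -> ell p f -> ell p (mask u f).
Proof.
move=> p0 fp; apply: (series_le_cvg _ _ _ fp) => k; rewrite ?powR_ge0// /mask.
by case: (u k) => //; rewrite Normc.normc0 powR0 ?gt_eqF ?powR_ge0.
Qed.

Lemma ell_delta (R : realType) (p : R) (j : nat) :
  0 < p -> ell p (@delta R[i] j).
Proof.
move=> p0; apply: cvgP; apply: (@cvgn_series_finite _ _ _ j.+1) => k jk.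
by rewrite /delta gtn_eqF// Normc.normc0 powR0 ?gt_eqF.
Qed.

Lemma ell_infty_mask (R : realType) (u : pred nat) (f : omega R) :
  ell_infty f -> ell_infty (mask u f).
Proof.
move=> [M [Mreal hM]]; exists M; split=> // x Mx k _ /=; rewrite /mask.
have fx := hM x Mx k I.
by case: (u k); [exact: fx | rewrite normr0; apply: le_trans fx].
Qed.

Lemma ell_infty_delta (R : realType) (j : nat) : @ell_infty R (@delta R[i] j).
Proof.
exists 1; split => // x x1 k _ /=; apply: le_trans (ltW x1).
by rewrite /delta; case: eqP; rewrite (normr1, normr0).
Qed.

Section RowTriangular.
Variables (R : realType) (X : set (omega R)) (A : nat -> nat -> R[i]^o).
Hypothesis X_mask : forall u f, X f -> X (mask u f).
Hypothesis X_delta : forall j, X (@delta R[i] j).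
Hypothesis A_triangular : forall m k, (m < k)%N -> A m k = 0.

Let row_sum (f : omega R) (m : nat) : R[i]^o :=
  \sum_(0 <= k < m.+1) A m k * f k.

Lemma triangular_series_cvg (f : omega R) m :
  series (fun k => A m k * f k) @ \oo --> row_sum f m.
Proof. by apply: cvgn_series_finite => k mk; rewrite A_triangular// mul0r. Qed.

Lemma matrix_class_triangular :
  matrix_class X (@cseq R) A <-> (forall f, X f -> cvgn (row_sum f)).
Proof.
have rowE f : (fun m => limn (series (fun k => A m k * f k))) = row_sum f.
  apply/funext => m; apply: cvg_lim; first exact: norm_hausdorff.
  exact: triangular_series_cvg.
split=> h f Xf; first by have [_] := h f Xf; rewrite rowE.
split=> [m|]; first exact: (cvgP (row_sum f m) (@triangular_series_cvg f m)).
by rewrite rowE; exact: h.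
Qed.

Hypothesis A_cvg : forall f, X f -> cvgn (row_sum f).

Lemma triangular_column_cvg k : cvgn (A^~ k).
Proof.
suff <- : row_sum (@delta R[i] k) = A^~ k by exact: A_cvg.
apply/funext => m; rewrite /row_sum; have [km|mk] := leqP k m; last first.
  rewrite A_triangular// big_nat_cond big1// => i /andP[/andP[_ im] _].
  by rewrite /delta ltn_eqF ?mulr0// (leq_trans im).
rewrite (bigD1_seq k) ?mem_index_iota ?iota_uniq//=.
rewrite /delta eqxx mulr1 big1 ?addr0// => i /negPf ->; exact: mulr0.
Qed.

(** The entries A_mk f_k form a matrix all of whose masked row sums converge,
    because masking them amounts to masking f inside X. *)
Lemma triangular_limit_series (f : omega R) : X f ->
  series (fun k => limn (A^~ k) * f k) @ \oo --> limn (row_sum f).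
Proof.
move=> Xf; pose B m k := A m k * f k : R[i]^o.
have -> : (fun k => limn (A^~ k) * f k) = (fun k => limn (B^~ k)).
  apply/funext => k; apply/esym/cvg_lim; first exact: norm_hausdorff.
  by apply: cvgMl; exact: triangular_column_cvg.
have -> : row_sum f = masked_row_sum B xpredT by [].
apply: series_column_limits => u.
suff -> : masked_row_sum B u = row_sum (mask u f) by exact/A_cvg/X_mask.
apply/funext => m; rewrite /masked_row_sum big_mkcond; apply: eq_bigr => k _.
by rewrite /mask; case: (u k); rewrite ?mulr0.
Qed.

End RowTriangular.

(** * Matrix transformations on the domain of the q-difference operator *)

Lemma psi_section_partial (R : realType) (q gamma : R) Phi j m k :
  psi_section q gamma Phi j m k = psi_partial q gamma Phi j k m.+1.
Proof.
rewrite /psi_section /psi_partial; case: leqP => // mk.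
by rewrite big_geq.
Qed.

Theorem theorem4p1 (R : realType) (q gamma p : R)
    (hq0 : 0 < q) (hq1 : q < 1) (hgamma : 0 < gamma) (hp : 0 < p)
    (X : set (omega R)) (hX : X = ell p \/ X = @ell_infty R)
    (Y : set (omega R)) (hY : sequence_space Y)
    (Phi : nat -> nat -> Cplx R) :
  matrix_class (nabla_domain q gamma X) Y Phi <->
  (forall j : nat, matrix_class X (@cseq R) (psi_section q gamma Phi j)) /\
  ((forall j k : nat, cvgn (psi_partial q gamma Phi j k)) /\
   matrix_class X Y (psi_matrix q gamma Phi)).
Proof.
have X_mask u f : X f -> X (mask u f).
  by case: hX => ->; [exact: ell_mask | exact: ell_infty_mask].
have X_delta j : X (@delta R[i] j).
  by case: hX => ->; [exact: ell_delta | exact: ell_infty_delta].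
pose A := psi_section q gamma Phi.
pose row_sum j f m : R[i]^o := \sum_(0 <= k < m.+1) A j m k * f k.
have A_triangular j m k : (m < k)%N -> A j m k = 0.
  by rewrite /A /psi_section ltnNge => /negPf ->.
(* The bijection from X onto the domain of the difference operator. *)
pose transform := conv (fun n => (bcoef q gamma n)%:C : R[i]^o).
have rowE j f m : row_sum j f m =
    series (fun k => Phi j k * transform f k) m.+1.
  rewrite /series/= /transform sum_mul_conv; apply: eq_bigr => k _.
  by rewrite /A psi_section_partial.
have row_cvg j f l : row_sum j f @ \oo --> l <->
    series (fun k => Phi j k * transform f k) @ \oo --> l.
  by rewrite (funext (rowE j f)) cvg_shiftS.
have row_is_cvg j f : cvgn (row_sum j f) <->
    cvgn (series (fun k => Phi j k * transform f k)).
  by split=> /row_cvg/cvgP.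
have row_lim j f : cvgn (row_sum j f) ->
    limn (series (fun k => Phi j k * transform f k)) = limn (row_sum j f).
  by move=> /row_cvg; apply: cvg_lim; exact: norm_hausdorff.
have column j k l : (A j)^~ k @ \oo --> l <->
    psi_partial q gamma Phi j k @ \oo --> l.
  rewrite (funext (fun m => psi_section_partial q gamma Phi j m k)).
  by rewrite cvg_shiftS.
have sections : (forall j, matrix_class X (@cseq R) (A j)) <->
    (forall j f, X f -> cvgn (row_sum j f)).
  by split=> h j; have := h j;
    rewrite (matrix_class_triangular X (A_triangular j)).
have limits : (forall j f, X f -> cvgn (row_sum j f)) ->
    (forall j k, cvgn (psi_partial q gamma Phi j k)) /\
    forall j f, X f ->
      series (fun k => psi_matrix q gamma Phi j k * f k) @ \oo -->
      limn (row_sum j f).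
  move=> row_cv.
  have col j k : psi_partial q gamma Phi j k @ \oo --> limn ((A j)^~ k).
    by apply/column/(triangular_column_cvg X_delta (A_triangular j) (row_cv j)).
  split=> [j k|j f Xf]; first exact: (cvgP _ (col j k)).
  have -> : psi_matrix q gamma Phi j = fun k => limn ((A j)^~ k).
    by apply/funext => k; apply: cvg_lim (col j k); exact: norm_hausdorff.
  exact: (triangular_limit_series X_mask X_delta (A_triangular j) (row_cv j)
    Xf).
split=> [PhiXY|[/sections row_cv [_ PsiXY]]].
- have Phi_transform f : X f ->
      (forall j, cvgn (series (fun k => Phi j k * transform f k))) /\
      Y (fun j => limn (series (fun k => Phi j k * transform f k))).
    by move=> Xf; apply: PhiXY; rewrite /nabla_domain/= nabla_conv.
  have row_cv j f : X f -> cvgn (row_sum j f).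
    by move=> /Phi_transform[h _]; apply/row_is_cvg.
  have [col_cv psi_cv] := limits row_cv.
  split; first exact/sections.
  split=> // f Xf; split=> [j|]; first exact: (cvgP _ (psi_cv j f Xf)).
  have [_] := Phi_transform _ Xf; congr (Y _); apply/funext => j.
  rewrite row_lim; last exact: row_cv.
  by apply/esym/cvg_lim; [exact: norm_hausdorff | exact: psi_cv].
- have [_ psi_cv] := limits row_cv.
  move=> g; rewrite -[g](nablaK gamma hq0 hq1) -/transform.
  rewrite {1}/nabla_domain/= nabla_conv//.
  move: (nabla q gamma g) => f Xf; split=> [j|].
    exact: (row_is_cvg j f).1 (row_cv j f Xf).
  have [_] := PsiXY _ Xf; congr (Y _); apply/funext => j.
  rewrite row_lim; last exact: row_cv.
  by apply/cvg_lim; [exact: norm_hausdorff | exact: psi_cv].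
Qed.
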